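(* Let $\mathcal{C}$ be a category with weak equivalences and $\mathcal{I}$ an index category such that $\mathcal{C}$ has $\mathcal{I}$-colimits. Then a homotopy colimit functor $\operatorname{hocolim}_{\mathcal{I}}\colon\operatorname{Ho}(\mathcal{C}^{\mathcal{I}})\to\operatorname{Ho}\mathcal{C}$ exists if and only if a derived colimit functor $\mathbb{L}\operatorname{colim}_{\mathcal{I}}\colon\operatorname{Ho}(\mathcal{C}^{\mathcal{I}})\to\operatorname{Ho}\mathcal{C}$ exists, and they are the same (i.e. isomorphic).
   Context: A category with weak equivalences is a category $\mathcal{C}$ with a class of morphisms (the weak equivalences), assumed to contain all isomorphisms. Its localisation $H_{\mathcal{C}}\colon\mathcal{C}\to\operatorname{Ho}\mathcal{C}$ sends weak equivalences to isomorphisms, and every functor out of $\mathcal{C}$ that does so factors uniquely (strictly) through $H_{\mathcal{C}}$. The diagram category $\mathcal{C}^{\mathcal{I}}$ carries the pointwise weak equivalences. The constant diagram functor $\Delta\colon\mathcal{C}\to\mathcal{C}^{\mathcal{I}}$ preserves weak equivalences and induces $\operatorname{Ho}\Delta\colon\operatorname{Ho}\mathcal{C}\to\operatorname{Ho}(\mathcal{C}^{\mathcal{I}})$ with $\operatorname{Ho}\Delta\circ H_{\mathcal{C}}=H_{\mathcal{C}^{\mathcal{I}}}\circ\Delta$. A homotopy colimit functor is a left adjoint of $\operatorname{Ho}\Delta$. A derived colimit functor is an absolute total left derived functor of $\operatorname{colim}_{\mathcal{I}}\colon\mathcal{C}^{\mathcal{I}}\to\mathcal{C}$, where an absolute total left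 derived functor of $F\colon\mathcal{A}\to\mathcal{B}$ is an absolute right Kan extension of $H_{\mathcal{B}}\circ F$ along $H_{\mathcal{A}}$ (a right Kan extension preserved by every functor out of $\operatorname{Ho}\mathcal{B}$). *)

(* Defs.v *)
From Stdlib Require Import FunctionalExtensionality ProofIrrelevance.

Set Implicit Arguments.
Unset Strict Implicit.
Unset Printing Implicit Defensive.

(* Universe convention: [Category] is universe monomorphic, and forming functor
   categories identifies the levels of objects and of morphisms.  All categories
   live in this one (arbitrary) universe, which is closed under diagram
   categories and localisations. *)

Record Category : Type := {
  Ob :> Type;
  Hom : Ob -> Ob -> Type;
  idm : forall x, Hom x x;
  comp : forall x y z, Hom y z -> Hom x y -> Hom x z;
  comp_id_l : forall x y (f : Hom x y), comp (idm y) f = f;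
  comp_id_r : forall x y (f : Hom x y), comp f (idm x) = f;
  comp_assoc : forall w x y z (h : Hom y z) (g : Hom x y) (f : Hom w x),
    comp h (comp g f) = comp (comp h g) f
}.

Arguments Hom {c} x y.
Arguments idm {c} x.
Arguments comp {c x y z} g f.

Declare Scope cat_scope.
Delimit Scope cat_scope with cat.
Open Scope cat_scope.

Notation "g ∘ f" := (comp g f) (at level 40, left associativity) : cat_scope.

Definition is_iso (C : Category) (x y : C) (f : Hom x y) : Prop :=
  exists g : Hom y x, g ∘ f = idm x /\ f ∘ g = idm y.

Definition isomorphic (C : Category) (x y : C) : Prop :=
  exists f : Hom x y, is_iso f.

Record Functor (A B : Category) : Type := {
  fob :> A -> B;
  fmap : forall x y, Hom x y -> Hom (fob x) (fob y);
  fmap_id : forall x, fmap (idm x) = idm (fob x);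
  fmap_comp : forall x y z (g : Hom y z) (f : Hom x y),
    fmap (g ∘ f) = fmap g ∘ fmap f
}.

Arguments fmap {A B} F {x y} f : rename.

Definition fid (A : Category) : Functor A A.
Proof.
refine {| fob := fun x => x; fmap := fun x y f => f |}; reflexivity.
Defined.

Definition fcomp (A B C : Category) (G : Functor B C) (F : Functor A B) :
  Functor A C.
Proof.
refine {| fob := fun x => G (F x); fmap := fun x y f => fmap G (fmap F f) |}.
- intros x; rewrite !fmap_id; reflexivity.
- intros x y z g f; rewrite !fmap_comp; reflexivity.
Defined.

Notation "G \o F" := (fcomp G F) (at level 50, left associativity) : cat_scope.

Record NatTrans (A B : Category) (F G : Functor A B) : Type := {
  ncomp :> forall x, Hom (F x) (G x);
  naturality : forall x y (f : Hom x y),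
    ncomp y ∘ fmap F f = fmap G f ∘ ncomp x
}.

Lemma nat_ext (A B : Category) (F G : Functor A B) (s t : NatTrans F G) :
  (forall x, s x = t x) -> s = t.
Proof.
destruct s as [s hs], t as [t ht]; simpl; intros E.
assert (s = t) by (apply functional_extensionality_dep; exact E).
subst t; f_equal; apply proof_irrelevance.
Qed.

Definition nid (A B : Category) (F : Functor A B) : NatTrans F F.
Proof.
refine {| ncomp := fun x => idm (F x) |}.
intros x y f; rewrite comp_id_l, comp_id_r; reflexivity.
Defined.

Definition vcomp (A B : Category) (F G K : Functor A B)
  (t : NatTrans G K) (s : NatTrans F G) : NatTrans F K.
Proof.
refine {| ncomp := fun x => t x ∘ s x |}.
intros x y f.
rewrite <- comp_assoc, naturality, comp_assoc, naturality, comp_assoc.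
reflexivity.
Defined.

Definition whisker_r (A B C : Category) (F G : Functor B C)
  (s : NatTrans F G) (H : Functor A B) : NatTrans (F \o H) (G \o H).
Proof.
refine (@Build_NatTrans _ _ (F \o H) (G \o H) (fun x => s (H x)) _).
intros x y f; exact (naturality s (fmap H f)).
Defined.

Definition FunCat (A B : Category) : Category.
Proof.
refine {| Ob := Functor A B;
          Hom := @NatTrans A B;
          idm := @nid A B;
          comp := @vcomp A B |}.
- intros x y f; apply nat_ext; intros a; apply comp_id_l.
- intros x y f; apply nat_ext; intros a; apply comp_id_r.
- intros w x y z h g f; apply nat_ext; intros a; apply comp_assoc.
Defined.

Record Adjunction (A B : Category) (L : Functor A B) (R : Functor B A) : Type := {
  unit : NatTrans (fid A) (R \o L);
  counit : NatTrans (L \o R) (fid B);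
  triangle_l : forall x : A, counit (L x) ∘ fmap L (unit x) = idm (L x);
  triangle_r : forall y : B, fmap R (counit y) ∘ unit (R y) = idm (R y)
}.

Definition is_left_adjoint (A B : Category) (L : Functor A B) (R : Functor B A) :
  Prop := inhabited (Adjunction L R).

(* Right Kan extension of [G] along [H], with counit [eps]. *)
Definition is_right_kan (A A' D : Category) (H : Functor A A') (G : Functor A D)
  (R : Functor A' D) (eps : NatTrans (R \o H) G) : Prop :=
  forall (K : Functor A' D) (alpha : NatTrans (K \o H) G),
    exists! beta : NatTrans K R, vcomp eps (whisker_r beta H) = alpha.

(* The whiskering of [eps] by [M], with source bracketed as [(M \o R) \o H]
   rather than [M \o (R \o H)]. *)
Definition kan_image (A A' D E : Category) (H : Functor A A') (G : Functor A D)
  (R : Functor A' D) (eps : NatTrans (R \o H) G) (M : Functor D E) :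
  NatTrans ((M \o R) \o H) (M \o G).
Proof.
refine (@Build_NatTrans _ _ ((M \o R) \o H) (M \o G)
          (fun x => fmap M (eps x)) _).
intros x y f; simpl; rewrite <- !fmap_comp.
f_equal; apply (naturality eps f).
Defined.

Definition is_absolute_right_kan (A A' D : Category) (H : Functor A A')
  (G : Functor A D) (R : Functor A' D) (eps : NatTrans (R \o H) G) : Prop :=
  is_right_kan eps /\
  forall (E : Category) (M : Functor D E), is_right_kan (kan_image eps M).

Record WECategory : Type := {
  wcat :> Category;
  weq : forall x y : wcat, Hom x y -> Prop;
  weq_iso : forall (x y : wcat) (f : Hom x y), is_iso f -> weq f
}.

Arguments weq {w x y} f.

Definition inverts (C : WECategory) (D : Category) (F : Functor C D) : Prop :=
  forall (x y : C) (f : Hom x y), weq f -> is_iso (fmap F f).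

Record Localisation (C : WECategory) : Type := {
  Ho : Category;
  loc : Functor C Ho;
  loc_inverts : inverts loc;
  loc_lift : forall (D : Category) (F : Functor C D), inverts F -> Functor Ho D;
  loc_lift_fac : forall (D : Category) (F : Functor C D) (hF : inverts F),
    loc_lift hF \o loc = F;
  loc_lift_uniq : forall (D : Category) (F : Functor C D) (hF : inverts F)
    (G : Functor Ho D), G \o loc = F -> G = loc_lift hF
}.

Definition Diag (C : WECategory) (I : Category) : WECategory.
Proof.
refine {| wcat := FunCat I C;
          weq := fun X Y (s : NatTrans X Y) => forall i, weq (s i) |}.
intros X Y s [t [ts st]] i; apply weq_iso; exists (t i); split.
- exact (f_equal (fun u : NatTrans X X => u i) ts).
- exact (f_equal (fun u : NatTrans Y Y => u i) st).
Defined.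

Definition const_diagram (C I : Category) (c : C) : Functor I C.
Proof.
refine {| fob := fun _ => c; fmap := fun _ _ _ => idm c |}.
- reflexivity.
- intros; symmetry; apply comp_id_l.
Defined.

Definition const_map (C I : Category) (c d : C) (f : Hom c d) :
  NatTrans (const_diagram I c) (const_diagram I d).
Proof.
refine (@Build_NatTrans _ _ (const_diagram I c) (const_diagram I d)
          (fun _ => f) _).
intros; simpl; rewrite comp_id_l, comp_id_r; reflexivity.
Defined.

Definition Delta (C I : Category) : Functor C (FunCat I C).
Proof.
refine (@Build_Functor C (FunCat I C) (const_diagram (C := C) I)
          (fun c d f => const_map I f) _ _).
- intros c; apply nat_ext; reflexivity.
- intros; apply nat_ext; reflexivity.
Defined.

Lemma Delta_inverts (C : WECategory) (I : Category)
  (LD : Localisation (Diag C I)) :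
  inverts (loc LD \o (Delta C I : Functor C (Diag C I))).
Proof.
intros x y f hf; apply (loc_inverts LD); intros i; exact hf.
Qed.

Definition HoDelta (C : WECategory) (I : Category)
  (LC : Localisation C) (LD : Localisation (Diag C I)) :
  Functor (Ho LC) (Ho LD) :=
  loc_lift LC (Delta_inverts LD).

Record Colimit (I C : Category) (X : Functor I C) : Type := {
  colim_ob : C;
  colim_cocone : NatTrans X (const_diagram I colim_ob);
  colim_univ : forall (c : C) (t : NatTrans X (const_diagram I c)),
    Hom colim_ob c;
  colim_fac : forall (c : C) (t : NatTrans X (const_diagram I c)),
    vcomp (const_map I (colim_univ t)) colim_cocone = t;
  colim_uniq : forall (c : C) (t : NatTrans X (const_diagram I c))
    (f : Hom colim_ob c), vcomp (const_map I f) colim_cocone = t ->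
    f = colim_univ t
}.

Definition has_colimits (C I : Category) : Type :=
  forall X : Functor I C, Colimit X.

Definition colim (C I : Category) (cl : has_colimits C I) :
  Functor (FunCat I C) C.
Proof.
refine (@Build_Functor (FunCat I C) C (fun X => colim_ob (cl X))
  (fun X Y (s : NatTrans X Y) =>
     colim_univ (cl X) (vcomp (colim_cocone (cl Y)) s)) _ _).
- intros X; symmetry; apply colim_uniq, nat_ext; intros i; simpl.
  rewrite comp_id_l, comp_id_r; reflexivity.
- intros X Y Z t s; symmetry; apply colim_uniq, nat_ext; intros i; simpl.
  pose proof (f_equal (fun u : NatTrans _ _ => u i)
    (colim_fac (cl X) (vcomp (colim_cocone (cl Y)) s))) as EX.
  pose proof (f_equal (fun u : NatTrans _ _ => u i)
    (colim_fac (cl Y) (vcomp (colim_cocone (cl Z)) t))) as EY.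
  simpl in EX, EY.
  rewrite <- comp_assoc, EX, comp_assoc, EY, comp_assoc; reflexivity.
Defined.

Definition is_hocolim (C : WECategory) (I : Category)
  (LC : Localisation C) (LD : Localisation (Diag C I))
  (L : Functor (Ho LD) (Ho LC)) : Prop :=
  is_left_adjoint L (HoDelta LC LD).

Definition is_abs_total_left_derived (A B : WECategory)
  (LA : Localisation A) (LB : Localisation B) (F : Functor A B)
  (L : Functor (Ho LA) (Ho LB)) : Prop :=
  exists eps : NatTrans (L \o loc LA) (loc LB \o F), is_absolute_right_kan eps.

Definition is_derived_colim (C : WECategory) (I : Category)
  (cl : has_colimits C I) (LC : Localisation C) (LD : Localisation (Diag C I))
  (L : Functor (Ho LD) (Ho LC)) : Prop :=
  is_abs_total_left_derived (colim cl : Functor (Diag C I) C) L.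

(* Main.v *)
(** Write H for the localisation functors.  Natural transformations between
    functors out of Ho C are the same as natural transformations between their
    restrictions to C.  Together with colim ⊣ Δ and HoΔ ∘ H = H ∘ Δ this gives,
    for all K : Ho(C^I) → E and M : Ho C → E, bijections
      Nat(K ∘ H, M ∘ H ∘ colim) ≅ Nat(K ∘ H ∘ Δ, M ∘ H) ≅ Nat(K ∘ HoΔ, M).
    L is an absolute Kan extension iff the left side is Nat(K, M ∘ L), and is
    left adjoint to HoΔ iff the right side is Nat(K, M ∘ L). *)

From Stdlib Require Import ProofIrrelevance.
Require Import Defs.

Set Implicit Arguments.
Unset Strict Implicit.
Unset Printing Implicit Defensive.

(** * Equations between composites and between functors *)

Lemma nat_eq_at (A B : Category) (F G : Functor A B) (s t : NatTrans F G) :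
  s = t -> forall x, s x = t x.
Proof. intros -> x; reflexivity. Qed.

(** Composites are kept bracketed to the right; this form lets an equation between twofold
    composites act at the head of a longer one. *)
Lemma comp_eq_assoc (C : Category) (w x y y' z : C)
  (g : Hom y z) (f : Hom x y) (g' : Hom y' z) (f' : Hom x y') :
  g ∘ f = g' ∘ f' -> forall h : Hom w x, g ∘ (f ∘ h) = g' ∘ (f' ∘ h).
Proof. intros E h; rewrite !comp_assoc, E; reflexivity. Qed.

Lemma comp_eq_id_assoc (C : Category) (w x y : C)
  (g : Hom y x) (f : Hom x y) :
  g ∘ f = idm x -> forall h : Hom w x, g ∘ (f ∘ h) = h.
Proof. intros E h; rewrite comp_assoc, E; apply comp_id_l. Qed.

Lemma fmap_eq (A B : Category) (F : Functor A B) (x y y' z : A)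
  (g : Hom y z) (f : Hom x y) (g' : Hom y' z) (f' : Hom x y') :
  g ∘ f = g' ∘ f' -> fmap F g ∘ fmap F f = fmap F g' ∘ fmap F f'.
Proof. intros E; rewrite <- !fmap_comp, E; reflexivity. Qed.

Lemma fmap_eq_id (A B : Category) (F : Functor A B) (x y : A)
  (g : Hom y x) (f : Hom x y) :
  g ∘ f = idm x -> fmap F g ∘ fmap F f = idm (F x).
Proof. intros E; rewrite <- fmap_comp, E; apply fmap_id. Qed.

(** Applies to functors with convertible object and morphism maps, such as the two bracketings of a
    threefold composite. *)
Lemma functor_proofs_irrelevant (A B : Category) (ob : A -> B)
  (mor : forall x y, Hom x y -> Hom (ob x) (ob y)) i i' c c' :
  @Build_Functor A B ob mor i c = @Build_Functor A B ob mor i' c'.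
Proof. f_equal; apply proof_irrelevance. Qed.

(** * The two-dimensional universal property of a localisation *)

(** Source and target are stored in the object, so one functor into this category encodes two
    functors and a transformation between them. *)
Definition arrow_category (D : Category) : Category.
Proof.
refine {|
  Ob := {x : D & {y : D & Hom x y}};
  Hom := fun a b =>
    {p : Hom (projT1 a) (projT1 b) * Hom (projT1 (projT2 a)) (projT1 (projT2 b))
     | snd p ∘ projT2 (projT2 a) = projT2 (projT2 b) ∘ fst p};
  idm := fun a => exist _ (idm _, idm _) _;
  comp := fun a b c g f =>
    exist _ (fst (proj1_sig g) ∘ fst (proj1_sig f),
             snd (proj1_sig g) ∘ snd (proj1_sig f)) _ |}.
Unshelve.
- intros x y [[f0 f1] e]; apply subset_eq_compat; simpl.
  rewrite !comp_id_l; reflexivity.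
- intros x y [[f0 f1] e]; apply subset_eq_compat; simpl.
  rewrite !comp_id_r; reflexivity.
- intros w x y z h g f; apply subset_eq_compat; simpl.
  rewrite !comp_assoc; reflexivity.
- simpl; rewrite comp_id_l, comp_id_r; reflexivity.
- destruct f as [[f0 f1] ef], g as [[g0 g1] eg]; simpl in *.
  rewrite <- comp_assoc, ef, comp_assoc, eg, comp_assoc; reflexivity.
Defined.

Definition arrow_dom (D : Category) : Functor (arrow_category D) D.
Proof.
refine (@Build_Functor (arrow_category D) D (fun a => projT1 a)
          (fun a b f => fst (proj1_sig f)) _ _); reflexivity.
Defined.

Definition arrow_cod (D : Category) : Functor (arrow_category D) D.
Proof.
refine (@Build_Functor (arrow_category D) D (fun a => projT1 (projT2 a))
          (fun a b f => snd (proj1_sig f)) _ _); reflexivity.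
Defined.

Definition arrow_functor (A D : Category) (F G : Functor A D)
  (s : NatTrans F G) : Functor A (arrow_category D).
Proof.
refine (@Build_Functor A (arrow_category D)
  (fun x => existT _ (F x) (existT _ (G x) (s x)))
  (fun x y f => exist _ (fmap F f, fmap G f) _) _ _).
Unshelve.
3: exact (eq_sym (naturality s f)).
- intros x; apply subset_eq_compat; rewrite !fmap_id; reflexivity.
- intros x y z g f; apply subset_eq_compat; simpl.
  rewrite !fmap_comp; reflexivity.
Defined.

Lemma arrow_functor_whisker (A B D : Category) (F G : Functor B D)
  (s : NatTrans F G) (H : Functor A B) :
  arrow_functor (whisker_r s H) = arrow_functor s \o H.
Proof.
apply (functor_proofs_irrelevant (A := A) (B := arrow_category D)
  (mor := fun x y f => fmap (arrow_functor s) (fmap H f))).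
Qed.

Lemma arrow_ob_eta (D : Category) (a : arrow_category D) :
  existT (fun x => {y : D & Hom x y}) (projT1 a)
    (existT _ (projT1 (projT2 a)) (projT2 (projT2 a))) = a.
Proof. destruct a as [x [y f]]; reflexivity. Qed.

Lemma arrow_ob_inj (D : Category) (x y : D) (f g : Hom x y) :
  existT (fun x => {y : D & Hom x y}) x (existT _ y f) =
  existT (fun x => {y : D & Hom x y}) x (existT _ y g) -> f = g.
Proof.
intros E.
apply ProofIrrelevanceTheory.EqdepTheory.inj_pair2 in E.
apply ProofIrrelevanceTheory.EqdepTheory.inj_pair2 in E.
exact E.
Qed.

Definition arrow_nat (A D : Category) (K : Functor A (arrow_category D)) :
  NatTrans (arrow_dom D \o K) (arrow_cod D \o K).
Proof.
refine (@Build_NatTrans _ _ (arrow_dom D \o K) (arrow_cod D \o K)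
          (fun x => projT2 (projT2 (K x))) _).
intros x y f; symmetry; exact (proj2_sig (fmap K f)).
Defined.

(** Both functors are lifts of [G \o loc LC], which inverts weak equivalences because [G] preserves
    isomorphisms. *)
Lemma loc_lift_unique (C : WECategory) (LC : Localisation C) (D : Category)
  (F G : Functor (Ho LC) D) : F \o loc LC = G \o loc LC -> F = G.
Proof.
intros E.
assert (hF : inverts (G \o loc LC)).
{ intros x y f hf; destruct (loc_inverts LC hf) as [g [gf fg]].
  exists (fmap G g); split; [exact (fmap_eq_id G gf) | exact (fmap_eq_id G fg)]. }
rewrite (loc_lift_uniq hF E).
symmetry; apply loc_lift_uniq; reflexivity.
Qed.

(** Full faithfulness of restriction along [H]. *)
Definition lifts_nat (A A' : Category) (H : Functor A A') : Prop :=
  forall (D : Category) (F G : Functor A' D) (s : NatTrans (F \o H) (G \o H)),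
    exists! t : NatTrans F G, whisker_r t H = s.

(* A natural transformation is a functor into the arrow category, to which the
   strict universal property applies. *)
Lemma loc_lifts_nat (C : WECategory) (LC : Localisation C) : lifts_nat (loc LC).
Proof.
intros D F G s.
set (P := arrow_functor s).
assert (hP : inverts P).
{ intros x y f hf; destruct (loc_inverts LC hf) as [g [gf fg]].
  pose proof (fmap_eq_id F gf) as F1; pose proof (fmap_eq_id F fg) as F2.
  pose proof (fmap_eq_id G gf) as G1; pose proof (fmap_eq_id G fg) as G2.
  unshelve eexists (exist _ (fmap F g, fmap G g) _).
  - simpl; pose proof (naturality s f) as N; simpl in N.
    rewrite <- (comp_id_r (fmap G g ∘ _)), <- F2, <- comp_assoc.
    rewrite (comp_eq_assoc N), (comp_eq_id_assoc G1); reflexivity.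
  - split; apply subset_eq_compat; simpl; [rewrite F1, G1 | rewrite F2, G2];
      reflexivity. }
pose proof (loc_lift_fac LC hP) as eK.
set (K := loc_lift LC hP) in *; clearbody K; clear hP.
assert (arrow_dom D \o K = F) as EF.
{ apply loc_lift_unique.
  transitivity (arrow_dom D \o (K \o loc LC)); [apply functor_proofs_irrelevant|].
  rewrite eK; apply functor_proofs_irrelevant. }
assert (arrow_cod D \o K = G) as EG.
{ apply loc_lift_unique.
  transitivity (arrow_cod D \o (K \o loc LC)); [apply functor_proofs_irrelevant|].
  rewrite eK; apply functor_proofs_irrelevant. }
subst F G.
exists (arrow_nat K); split.
- apply nat_ext; intros c.
  apply arrow_ob_inj.
  pose proof (f_equal (fun Q : Functor _ _ => Q c) eK) as E; simpl in E.
  exact (eq_trans (arrow_ob_eta _) E).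
(* A second lift [t] gives a functor with the same restriction as [K], hence [K] itself. *)
- intros t Et; apply nat_ext; intros x; apply arrow_ob_inj.
  assert (E : K = arrow_functor t).
  { apply loc_lift_unique; rewrite eK; unfold P; rewrite <- Et.
    apply arrow_functor_whisker. }
  pose proof (f_equal (fun Q : Functor _ _ => Q x) E) as Ex; simpl in Ex.
  exact (eq_trans (arrow_ob_eta _) Ex).
Qed.

(** * Adjunctions and absolute Kan extensions *)

Section AbsoluteKan.

Variables (A C A' C' : Category) (Ha : Functor A A') (Hc : Functor C C').
Variables (S : Functor A C) (T : Functor C A) (adj : Adjunction S T).
(* [T' \o Hc] and [Ha \o T] are strictly equal in the application; working with
   an isomorphism between them avoids transport along that equality. *)
Variables (T' : Functor C' A') (th : NatTrans (T' \o Hc) (Ha \o T))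
  (th' : NatTrans (Ha \o T) (T' \o Hc)).
Hypotheses
  (th'K : forall c,
    comp (x := T' (Hc c)) (y := Ha (T c)) (z := T' (Hc c)) (th' c) (th c) =
    idm (T' (Hc c)))
  (thK : forall c,
    comp (x := Ha (T c)) (y := T' (Hc c)) (z := Ha (T c)) (th c) (th' c) =
    idm (Ha (T c))).
Hypothesis (HcL : lifts_nat Hc).

(** The composite [L Ha → L Ha T S ≅ L T' Hc S → Hc S] of the unit of [adj], [th'] and the counit of
    [adj']. *)
Definition derived_counit (L : Functor A' C') (adj' : Adjunction L T') :
  NatTrans (L \o Ha) (Hc \o S).
Proof.
refine (@Build_NatTrans _ _ (L \o Ha) (Hc \o S)
  (fun x => counit adj' (Hc (S x)) ∘
            (fmap L (th' (S x)) ∘ fmap L (fmap Ha (unit adj x)))) _).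
intros x y f; simpl.
pose proof (fmap_eq L (fmap_eq Ha (naturality (unit adj) f))) as N1; simpl in N1.
pose proof (fmap_eq L (naturality th' (fmap S f))) as N2; simpl in N2.
pose proof (naturality (counit adj') (fmap Hc (fmap S f))) as N3; simpl in N3.
rewrite <- !comp_assoc, N1, (comp_eq_assoc N2), (comp_eq_assoc N3); reflexivity.
Defined.

(** The adjunct under [L ⊣ T'], computed by naturality of the unit and a triangle identity of
    [adj']. *)
Lemma derived_counit_transpose (L : Functor A' C') (adj' : Adjunction L T') x :
  fmap T' (derived_counit adj' x) ∘ unit adj' (Ha x) =
  th' (S x) ∘ fmap Ha (unit adj x).
Proof.
simpl; rewrite fmap_comp, <- comp_assoc.
pose proof (naturality (unit adj') (th' (S x) ∘ fmap Ha (unit adj x))) as N.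
simpl in N; rewrite fmap_comp in N; rewrite <- N.
exact (comp_eq_id_assoc (triangle_r adj' (Hc (S x))) _).
Qed.

(** The triangle identity of [adj] cancels the unit inside the derived counit, and [th'] cancels
    [th]. *)
Lemma counit_derived_counit (L : Functor A' C') (adj' : Adjunction L T') c :
  fmap Hc (counit adj c) ∘ (derived_counit adj' (T c) ∘ fmap L (th c)) =
  counit adj' (Hc c).
Proof.
simpl.
pose proof (naturality (counit adj') (fmap Hc (counit adj c))) as N1; simpl in N1.
pose proof (fmap_eq L (naturality th' (counit adj c))) as N2; simpl in N2.
rewrite <- !comp_assoc, (comp_eq_assoc (eq_sym N1)), (comp_eq_assoc (eq_sym N2)).
rewrite (comp_eq_id_assoc (fmap_eq_id L (fmap_eq_id Ha (triangle_r adj c)))).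
rewrite (fmap_eq_id L (th'K c)); apply comp_id_r.
Qed.

(** [al] is transposed along [S ⊣ T] to [g0], extended over [Hc] to [g], and transposed along
    [L ⊣ T'] to [be]; uniqueness follows by going back. *)
Lemma derived_counit_kan (L : Functor A' C') (adj' : Adjunction L T')
  (E : Category) (M : Functor C' E) (K : Functor A' E)
  (al : NatTrans (K \o Ha) (M \o (Hc \o S))) :
  exists! be : NatTrans K (M \o L),
    vcomp (kan_image (derived_counit adj') M) (whisker_r be Ha) = al.
Proof.
(* Only the component formula is kept, so that [simpl] cannot unfold the transformation; the same
   device recurs below. *)
assert (exists g0 : NatTrans ((K \o T') \o Hc) (M \o Hc), forall c,
  g0 c = fmap M (fmap Hc (counit adj c)) ∘ (al (T c) ∘ fmap K (th c)))
  as [g0 Eg0].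
{ unshelve eexists (@Build_NatTrans _ _ ((K \o T') \o Hc) (M \o Hc) _ _);
    [| | intros c; reflexivity].
  intros x y f; simpl.
  pose proof (fmap_eq K (naturality th f)) as N1; simpl in N1.
  pose proof (naturality al (fmap T f)) as N2; simpl in N2.
  pose proof (fmap_eq M (fmap_eq Hc (naturality (counit adj) f))) as N3; simpl in N3.
  rewrite <- !comp_assoc, N1, (comp_eq_assoc N2), (comp_eq_assoc N3); reflexivity. }
destruct (HcL g0) as [g [Eg Ug]].
assert (Eg' : forall c, g (Hc c) =
  fmap M (fmap Hc (counit adj c)) ∘ (al (T c) ∘ fmap K (th c))).
{ intros c; rewrite <- Eg0, <- Eg; reflexivity. }
assert (exists be : NatTrans K (M \o L), forall y,
  be y = g (L y) ∘ fmap K (unit adj' y)) as [be Ebe].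
{ unshelve eexists (@Build_NatTrans _ _ K (M \o L) _ _);
    [| | intros c; reflexivity].
  intros x y f; simpl.
  pose proof (fmap_eq K (naturality (unit adj') f)) as N1; simpl in N1.
  pose proof (naturality g (fmap L f)) as N2; simpl in N2.
  rewrite <- !comp_assoc, N1, (comp_eq_assoc N2); reflexivity. }
exists be; split.
- apply nat_ext; intros x; simpl.
  rewrite Ebe; simpl.
  pose proof (naturality g (derived_counit adj' x)) as N1; simpl in N1.
  rewrite (comp_eq_assoc (eq_sym N1)).
  pose proof (derived_counit_transpose adj' x) as N2; simpl in N2.
  rewrite (fmap_eq K N2), Eg'; simpl; rewrite <- !comp_assoc.
  rewrite (comp_eq_id_assoc (fmap_eq_id K (thK (S x)))).
  pose proof (naturality al (unit adj x)) as N3; simpl in N3.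
  rewrite N3.
  exact (comp_eq_id_assoc (fmap_eq_id M (fmap_eq_id Hc (triangle_l adj x))) _).
- intros be' Ebe'; pose proof (nat_eq_at Ebe') as Ebe2; simpl in Ebe2.
  (* Transposing [be'] back along [L ⊣ T'] gives a second extension of [g0], which must be [g]. *)
  assert (exists g' : NatTrans (K \o T') M, forall z,
    g' z = fmap M (counit adj' z) ∘ be' (T' z)) as [g' Eg2].
  { unshelve eexists (@Build_NatTrans _ _ (K \o T') M _ _);
      [| | intros z; reflexivity].
    intros x y f; simpl.
    pose proof (naturality be' (fmap T' f)) as N1; simpl in N1.
    pose proof (fmap_eq M (naturality (counit adj') f)) as N2; simpl in N2.
    rewrite <- comp_assoc, N1, (comp_eq_assoc N2), comp_assoc; reflexivity. }
  assert (g = g') as <-.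
  { apply Ug, nat_ext; intros c; simpl; rewrite Eg2, Eg0, <- Ebe2.
    pose proof (naturality be' (th c)) as N1; simpl in N1.
    rewrite <- (counit_derived_counit adj' c), !fmap_comp; simpl.
    rewrite <- !comp_assoc, N1, !fmap_comp, <- !comp_assoc; reflexivity. }
  apply nat_ext; intros y; rewrite Ebe, Eg2; simpl.
  pose proof (naturality be' (unit adj' y)) as N1; simpl in N1.
  rewrite <- comp_assoc, N1.
  exact (comp_eq_id_assoc (fmap_eq_id M (triangle_l adj' y)) _).
Qed.

(* Needed because [fid C' \o L] and [L] are not convertible. *)
Lemma kan_image_fid (L : Functor A' C') (eps : NatTrans (L \o Ha) (Hc \o S)) :
  is_right_kan (kan_image eps (fid C')) -> is_right_kan eps.
Proof.
intros kan K al.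
destruct (kan K (@Build_NatTrans _ _ (K \o Ha) (fid C' \o (Hc \o S))
  (fun x => al x) (fun x y f => naturality al f))) as [be [Ebe Ube]].
exists (@Build_NatTrans _ _ K L (fun x => be x) (fun x y f => naturality be f)).
split.
- apply nat_ext; intros x; exact (nat_eq_at Ebe x).
- intros be' Ebe'; apply nat_ext; intros y; simpl.
  rewrite (Ube (@Build_NatTrans _ _ K (fid C' \o L) (fun x => be' x)
    (fun x y f => naturality be' f))); [reflexivity|].
  apply nat_ext; intros x; exact (nat_eq_at Ebe' x).
Qed.

Lemma derived_counit_absolute (L : Functor A' C') (adj' : Adjunction L T') :
  is_absolute_right_kan (derived_counit adj').
Proof.
assert (forall E (M : Functor C' E), is_right_kan (kan_image (derived_counit adj') M))
  as kan by (intros E M K al; apply derived_counit_kan).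
split; [apply kan_image_fid, kan | exact kan].
Qed.

(** The counit extends a transpose of [eps] over [Hc]; the unit comes from preservation of the Kan
    extension by [T']. The two uniqueness properties give the triangle identities. *)
Lemma absolute_kan_adjunction (L : Functor A' C')
  (eps : NatTrans (L \o Ha) (Hc \o S)) :
  is_absolute_right_kan eps -> is_left_adjoint L T'.
Proof.
intros [kan abs].
(* The counit on the image of [Hc]: [L T' Hc ≅ L Ha T → Hc S T → Hc]. *)
assert (exists e0 : NatTrans ((L \o T') \o Hc) (fid C' \o Hc), forall c,
  e0 c = fmap Hc (counit adj c) ∘ (eps (T c) ∘ fmap L (th c))) as [e0 Ee0].
{ unshelve eexists (@Build_NatTrans _ _ ((L \o T') \o Hc) (fid C' \o Hc) _ _);
    [| | intros c; reflexivity].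
  intros x y f; simpl.
  pose proof (fmap_eq L (naturality th f)) as N1; simpl in N1.
  pose proof (naturality eps (fmap T f)) as N2; simpl in N2.
  pose proof (fmap_eq Hc (naturality (counit adj) f)) as N3; simpl in N3.
  rewrite <- !comp_assoc, N1, (comp_eq_assoc N2), (comp_eq_assoc N3); reflexivity. }
destruct (HcL e0) as [e [Ee _]].
assert (Eeps : forall c,
  e (Hc c) = fmap Hc (counit adj c) ∘ (eps (T c) ∘ fmap L (th c))).
{ intros c; rewrite <- Ee0, <- Ee; reflexivity. }
clear e0 Ee0 Ee; simpl in Eeps.
assert (exists u0 : NatTrans (fid A' \o Ha) (T' \o (Hc \o S)), forall x,
  u0 x = th' (S x) ∘ fmap Ha (unit adj x)) as [u0 Eu0].
{ unshelve eexists (@Build_NatTrans _ _ (fid A' \o Ha) (T' \o (Hc \o S)) _ _);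
    [| | intros c; reflexivity].
  intros x y f; simpl.
  pose proof (fmap_eq Ha (naturality (unit adj) f)) as N1; simpl in N1.
  pose proof (naturality th' (fmap S f)) as N2; simpl in N2.
  rewrite <- !comp_assoc, N1, (comp_eq_assoc N2); reflexivity. }
(* [T' \o L] is a right Kan extension of [T' \o (Hc \o S)]; testing it against the identity functor
   yields a map of the type of a unit. *)
destruct (abs _ T' (fid A') u0) as [u [Eu _]].
assert (Ueps : forall x,
  fmap T' (eps x) ∘ u (Ha x) = th' (S x) ∘ fmap Ha (unit adj x)).
{ intros x; rewrite <- Eu0, <- Eu; reflexivity. }
clear u0 Eu0 Eu; simpl in Ueps.
assert (TL : forall y, e (L y) ∘ fmap L (u y) = idm (L y)).
(* [eps] factors uniquely through itself; the triangle composite and the identity are both such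
   factors. *)
{ destruct (kan L eps) as [i [_ Ui]].
  assert (exists t : NatTrans L L, forall y, t y = e (L y) ∘ fmap L (u y)) as [t Et].
  { unshelve eexists (@Build_NatTrans _ _ L L _ _); [| | intros c; reflexivity].
    intros x y f; simpl.
    pose proof (fmap_eq L (naturality u f)) as N1; simpl in N1.
    pose proof (naturality e (fmap L f)) as N2; simpl in N2.
    rewrite <- !comp_assoc, N1, (comp_eq_assoc N2); reflexivity. }
  assert (t = nid L) as E.
  { rewrite <- (Ui t), <- (Ui (nid L)); [reflexivity| |];
      apply nat_ext; intros x; simpl; [apply comp_id_r|].
    rewrite Et; simpl.
    pose proof (naturality e (eps x)) as N1; simpl in N1.
    rewrite (comp_eq_assoc (eq_sym N1)), (fmap_eq L (Ueps x)), Eeps.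
    rewrite <- !comp_assoc, (comp_eq_id_assoc (fmap_eq_id L (thK (S x)))).
    pose proof (naturality eps (unit adj x)) as N2; simpl in N2.
    rewrite N2.
    exact (comp_eq_id_assoc (fmap_eq_id Hc (triangle_l adj x)) _). }
  intros y; rewrite <- Et, E; reflexivity. }
assert (TR : forall z, fmap T' (e z) ∘ u (T' z) = idm (T' z)).
(* The triangle composite and the identity of [T'] agree after restriction along [Hc], hence are
   equal. *)
{ destruct (HcL (whisker_r (nid T') Hc)) as [i [_ Ui]].
  assert (exists t : NatTrans T' T', forall z, t z = fmap T' (e z) ∘ u (T' z))
    as [t Et].
  { unshelve eexists (@Build_NatTrans _ _ T' T' _ _); [| | intros c; reflexivity].
    intros x y f; simpl.
    pose proof (naturality u (fmap T' f)) as N1; simpl in N1.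
    pose proof (fmap_eq T' (naturality e f)) as N2; simpl in N2.
    rewrite <- !comp_assoc, N1, (comp_eq_assoc N2); reflexivity. }
  assert (t = nid T') as E.
  { rewrite <- (Ui t), <- (Ui (nid T')); [reflexivity|reflexivity|].
    apply nat_ext; intros c; simpl; rewrite Et, Eeps; simpl.
    rewrite !fmap_comp, <- !comp_assoc.
    pose proof (naturality u (th c)) as N1; simpl in N1; rewrite <- N1.
    rewrite (comp_eq_assoc (Ueps (T c))).
    pose proof (naturality th' (counit adj c)) as N2; simpl in N2.
    rewrite (comp_eq_assoc (eq_sym N2)).
    rewrite (comp_eq_id_assoc (fmap_eq_id Ha (triangle_r adj c))); apply th'K. }
  intros z; rewrite <- Et, E; reflexivity. }
constructor.
exact (@Build_Adjunction _ _ L T'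
  (@Build_NatTrans _ _ (fid A') (T' \o L) (fun y => u y) (fun x y f => naturality u f))
  (@Build_NatTrans _ _ (L \o T') (fid C') (fun z => e z) (fun x y f => naturality e f))
  TL TR).
Qed.

End AbsoluteKan.

(** * Uniqueness of right Kan extensions *)

Lemma right_kan_unique (A A' D : Category) (H : Functor A A') (G : Functor A D)
  (R R' : Functor A' D) (eps : NatTrans (R \o H) G) (eps' : NatTrans (R' \o H) G) :
  is_right_kan eps -> is_right_kan eps' -> @isomorphic (FunCat A' D) R R'.
Proof.
assert (endo : forall (Q : Functor A' D) (d : NatTrans (Q \o H) G) (t : NatTrans Q Q),
  is_right_kan d -> vcomp d (whisker_r t H) = d -> t = nid Q).
{ intros Q d t kan Et; destruct (kan Q d) as [i [_ Ui]].
  rewrite <- (Ui t Et); apply Ui, nat_ext; intros x; apply comp_id_r. }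
intros kan kan'.
(* The two comparison maps compose to endomorphisms compatible with the counits, hence to identities
   by [endo]. *)
destruct (kan R' eps') as [s [Es _]], (kan' R eps) as [t [Et _]].
pose proof (nat_eq_at Es) as Es'; pose proof (nat_eq_at Et) as Et'.
exists t, s; split.
- apply (endo R eps); [exact kan|].
  apply nat_ext; intros x; simpl in *; rewrite comp_assoc, Es'; apply Et'.
- apply (endo R' eps'); [exact kan'|].
  apply nat_ext; intros x; simpl in *; rewrite comp_assoc, Et'; apply Es'.
Qed.

(** Turns the strict equation [HoΔ ∘ H = H ∘ Δ] into the pair [th], [th']. *)
Lemma functor_eq_iso (A B : Category) (F G : Functor A B) :
  F = G -> exists (s : NatTrans F G) (t : NatTrans G F),
    (forall x, t x ∘ s x = idm (F x)) /\ (forall x, s x ∘ t x = idm (G x)).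
Proof.
intros <-; exists (nid F), (nid F); split; intros x; apply comp_id_l.
Qed.

(** * The adjunction between colimits and constant diagrams *)

Lemma colim_fac_at (C I : Category) (X : Functor I C) (l : Colimit X) (c : C)
  (t : NatTrans X (const_diagram I c)) i :
  comp (x := X i) (y := colim_ob l) (z := c) (colim_univ l t) (colim_cocone l i) =
  t i.
Proof. exact (nat_eq_at (colim_fac l t) i). Qed.

Lemma colim_map_ext (C I : Category) (X : Functor I C) (l : Colimit X) (c : C)
  (f g : Hom (colim_ob l) c) :
  (forall i, f ∘ colim_cocone l i = g ∘ colim_cocone l i) -> f = g.
Proof.
intros E; rewrite (colim_uniq (eq_refl (vcomp (const_map I g) (colim_cocone l)))).
apply colim_uniq, nat_ext; exact E.
Qed.

Definition colim_adjunction (C I : Category) (cl : has_colimits C I) :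
  Adjunction (colim cl) (Delta C I).
Proof.
unshelve refine (@Build_Adjunction _ _ (colim cl) (Delta C I)
  (@Build_NatTrans _ _ (fid (FunCat I C)) (Delta C I \o colim cl)
     (fun X => colim_cocone (cl X)) _)
  (@Build_NatTrans _ _ (colim cl \o Delta C I) (fid C)
     (fun c => colim_univ (cl (const_diagram I c)) (nid (const_diagram I c))) _) _ _).
- intros X Y f; apply nat_ext; intros i; simpl; symmetry.
  exact (colim_fac_at _ _ i).
- intros c d f; apply colim_map_ext; intros i; simpl.
  pose proof (fun b z t => colim_fac_at (cl (const_diagram I b)) (c := z) t i) as E.
  simpl in E; rewrite <- !comp_assoc, !E; simpl; rewrite comp_assoc, E; simpl.
  rewrite comp_id_l, comp_id_r; reflexivity.
- intros X; apply colim_map_ext; intros i; simpl.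
  rewrite <- comp_assoc, colim_fac_at; simpl.
  pose proof (colim_fac_at (cl (const_diagram I (colim_ob (cl X)))) (nid _) i) as E.
  simpl in E; rewrite comp_assoc, E; reflexivity.
- intros c; apply nat_ext; intros i; exact (colim_fac_at _ _ i).
Defined.

(** * Homotopy colimits compared with derived colimits *)

Theorem proposition7p4 (C : WECategory) (I : Category) (cl : has_colimits C I)
  (LC : Localisation C) (LD : Localisation (Diag C I)) :
  ((exists hocolim : Functor (Ho LD) (Ho LC), is_hocolim hocolim) <->
   (exists Lcolim : Functor (Ho LD) (Ho LC), is_derived_colim cl Lcolim)) /\
  (forall hocolim Lcolim : Functor (Ho LD) (Ho LC),
     is_hocolim hocolim -> is_derived_colim cl Lcolim ->
     @isomorphic (FunCat (Ho LD) (Ho LC)) hocolim Lcolim).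
Proof.
destruct (functor_eq_iso (loc_lift_fac LC (Delta_inverts LD)))
  as [th [th' [th'K thK]]].
pose proof (@loc_lifts_nat C LC) as HcL.
set (adj := colim_adjunction cl : @Adjunction (Diag C I) C (colim cl) (Delta C I)).
(* The same [L] is kept, so the isomorphism claim reduces to comparing two Kan extensions of one
   functor. *)
assert (fwd : forall L : Functor (Ho LD) (Ho LC),
  is_hocolim L -> is_derived_colim cl L).
{ intros L [adj'].
  exists (derived_counit adj th' adj').
  exact (derived_counit_absolute adj th'K thK HcL adj'). }
split; [split|].
- intros [L hL]; exists L; apply fwd, hL.
- intros [L [eps heps]]; exists L.
  exact (absolute_kan_adjunction adj th'K thK HcL heps).
- intros L L' hL [eps' [kan' _]].
  destruct (fwd L hL) as [eps [kan _]].
  exact (right_kan_unique kan kan').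
Qed.
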